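(* Let $\mathcal{H}$ be a complex Hilbert space of finite dimension $n\ge2$, $m\ge2$, and let $\mathcal{G}=(\{1,\dots,m\},E)$ be a connected undirected graph. Fix $\alpha\in(0,1)$. The quantum gossip algorithm evolves a density operator on $\mathcal{H}^{\otimes m}$ by, at each time $t$, selecting an edge $(j,k)\in E$ and applying $$\rho(t+1)=\mathcal{E}_{j,k}(\rho(t))=(1-\alpha)\rho(t)+\alpha\,U_{(j,k)}\rho(t)U_{(j,k)}^\dagger .$$ Let $\rho_0=\rho(0)$ and $\rho_*=\frac{1}{m!}\sum_{\pi}U_\pi\rho_0U_\pi^\dagger$ (sum over all permutations of $\{1,\dots,m\}$). Then: (i) if the edges are selected deterministically by periodically cycling, in any predefined way, through the set of edges (each period containing every edge), then $\rho(t)\to\rho_*$, and the system converges to symmetric state consensus (SSC) for every initial state; (ii) if at each time the edge is selected independently at random according to a fixed distribution $\{q_{j,k}>0\}$ with $\sum_{(j,k)\in E}q_{j,k}=1$, then the expected state, which evolves as $\rho(t+1)=\sum_{(j,k)\in E}q_{j,k}\mathcal{E}_{j,k}(\rho(t))$, converges to $\rho_*$, hence to SSC; (iii) with the same random edge selection, convergence holds with probability one along trajectories in the sense that for any $\delta,\varepsilon>0$ there exists $T>0$ such that $\mathbb{P}[\mathrm{Tr}((\rho(T)-\rho_* )^2)>\varepsilon]<\delta$, where $\rho_*\in\mathcal{C}_{\rm SSC}$. Furthermore, for these evolutions, $S$-average SSC is attained for a self-adjoint $S$ on $\mathcal{H}^{\otimes m}$ if and only if there exists a self-adjoint $\sigma$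 on $\mathcal{H}$ with $S=\frac1m\sum_{i=1}^m\sigma^{(i)}$.
   Context: For $X$ an operator on $\mathcal{H}$, $X^{(i)}=I^{\otimes(i-1)}\otimes X\otimes I^{\otimes(m-i)}$. For a permutation $\pi$ of $\{1,\dots,m\}$, $U_\pi$ is the unitary on $\mathcal{H}^{\otimes m}$ with $U_\pi(X_1\otimes\cdots\otimes X_m)U_\pi^\dagger=X_{\pi(1)}\otimes\cdots\otimes X_{\pi(m)}$; $U_{(j,k)}$ is $U_\pi$ for the transposition of $j,k$. A density operator $\rho$ is in symmetric state consensus (SSC) if $U_\pi\rho U_\pi^\dagger=\rho$ for all $\pi$; $\mathcal{C}_{\rm SSC}$ is the set of such states. A sequence of channels with $\rho(t)=\hat{\mathcal{E}}_t(\rho_0)$ asymptotically achieves SSC if $\lim_t \inf_{\rho\in\mathcal{C}_{\rm SSC}}\|\rho(t)-\rho\|=0$ for all initial states $\rho_0$ (any $p$-norm). It asymptotically achieves $S$-average SSC, for self-adjoint $S$ on $\mathcal{H}^{\otimes m}$, if it asymptotically achieves SSC and there exists a self-adjoint $\sigma$ on $\mathcal{H}$ such that for all initial states $\rho_0$ and all $\ell\in\{1,\dots,m\}$: $\lim_t\mathrm{Tr}(\sigma^{(\ell)}\rho(t))=\lim_t\mathrm{Tr}(S\rho(t))=\mathrm{Tr}(S\rho_0)$. *)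

(* Defs.v *)
From HB Require Import structures.
From mathcomp Require Import all_boot all_order all_algebra all_fingroup.
From mathcomp Require Import all_classical all_reals all_analysis.
From mathcomp Require Import complex.
Set Implicit Arguments. Unset Strict Implicit. Unset Printing Implicit Defensive.
Import Order.TTheory GRing.Theory Num.Theory.
Import numFieldNormedType.Exports.
Local Open Scope ring_scope.
Local Open Scope complex_scope.
Local Open Scope classical_set_scope.

(* Conventions.
   - The Hilbert space H of dimension n is C^n with orthonormal basis indexed by 'I_n.
   - H^{(x)m} has the product basis indexed by [tbasis n m] = {ffun 'I_m -> 'I_n}
     (x : 'I_m -> 'I_n is the basis vector |x 0> (x) ... (x) |x (m-1)>).
   - An operator on a space with orthonormal basis indexed by a finite type X is
     its matrix X -> X -> R[i] (R a real field, R[i] its complex numbers). *)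

Definition tbasis (n m : nat) := {ffun 'I_m -> 'I_n}.

Definition op (R : rcfType) (X : finType) := X -> X -> R[i].

Section Ops.
Variables (R : rcfType) (X : finType).

Definition opmul (A B : op R X) : op R X := fun x y => \sum_(z : X) A x z * B z y.
Definition adj (A : op R X) : op R X := fun x y => (A y x)^*.
Definition tr (A : op R X) : R[i] := \sum_(x : X) A x x.
Definition opsub (A B : op R X) : op R X := fun x y => A x y - B x y.

Definition selfadj (A : op R X) : Prop := adj A = A.

Definition density (A : op R X) : Prop :=
  [/\ selfadj A,
      (forall v : X -> R[i], 0 <= \sum_(x : X) \sum_(y : X) (v x)^* * A x y * v y)
    & tr A = 1].

(* Hilbert-Schmidt (Schatten 2-) norm  ||A||_2 = sqrt (Tr (A^dag A)) *)
Definition hsnorm (A : op R X) : R :=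
  Num.sqrt (\sum_(x : X) \sum_(y : X)
              (complex.Re (A x y) ^+ 2 + complex.Im (A x y) ^+ 2)).

Definition cmod (z : R[i]) : R := Num.sqrt (complex.Re z ^+ 2 + complex.Im z ^+ 2).

Definition conjU (U rho : op R X) : op R X := opmul (opmul U rho) (adj U).
End Ops.

Section Tensor.
Variables (R : realType) (n m : nat).

(* U_pi : (U_pi v)(x) = v(x o pi^-1), so that
   U_pi (X_1 (x) ... (x) X_m) U_pi^dag = X_{pi 1} (x) ... (x) X_{pi m}. *)
Definition Uperm (s : {perm 'I_m}) : op R (tbasis n m) :=
  fun x y => ((y == [ffun i => x ((s^-1)%g i)]) : nat)%:R.

(* X^{(i)} = I (x) ... (x) X (x) ... (x) I   (X at position i) *)
Definition loc (i : 'I_m) (sigma : op R 'I_n) : op R (tbasis n m) :=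
  fun x y => sigma (x i) (y i) * \prod_(l : 'I_m | l != i) ((x l == y l) : nat)%:R.

Definition avg_loc (sigma : op R 'I_n) : op R (tbasis n m) :=
  fun x y => (m%:R)^-1 * \sum_(i : 'I_m) loc i sigma x y.

Definition SSC (rho : op R (tbasis n m)) : Prop :=
  density rho /\ forall s : {perm 'I_m}, conjU (Uperm s) rho = rho.

Definition rhostar (rho0 : op R (tbasis n m)) : op R (tbasis n m) :=
  fun x y => ((m`!)%:R)^-1 * \sum_(s : {perm 'I_m}) conjU (Uperm s) rho0 x y.

Definition gossip (alpha : R) (e : 'I_m * 'I_m) (rho : op R (tbasis n m))
  : op R (tbasis n m) :=
  fun x y => (1 - alpha)%:C * rho x y
             + alpha%:C * conjU (Uperm (tperm e.1 e.2)) rho x y.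

Definition evol_word (alpha : R) (w : seq ('I_m * 'I_m)) (rho0 : op R (tbasis n m))
  : op R (tbasis n m) :=
  foldl (fun rho e => gossip alpha e rho) rho0 w.

Definition evol_seq (alpha : R) (sq : nat -> 'I_m * 'I_m) (rho0 : op R (tbasis n m))
  (t : nat) : op R (tbasis n m) :=
  evol_word alpha [seq sq i | i <- iota 0 t] rho0.

Fixpoint evol_avg (alpha : R) (E : {set 'I_m * 'I_m}) (q : 'I_m * 'I_m -> R)
  (rho0 : op R (tbasis n m)) (t : nat) : op R (tbasis n m) :=
  match t with
  | 0 => rho0
  | t'.+1 => fun x y =>
      \sum_(e in E) (q e)%:C * gossip alpha e (evol_avg alpha E q rho0 t') x y
  end.

(* probability, for i.i.d. edges with law q on E, that the first T selected
   edges w satisfy P *)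
Definition prob_word (E : {set 'I_m * 'I_m}) (q : 'I_m * 'I_m -> R) (T : nat)
  (P : seq ('I_m * 'I_m) -> bool) : R :=
  \sum_(w : T.-tuple ('I_m * 'I_m) | all (mem E) w && P w) \prod_(e <- w) q e.

Definition cvgC (u : nat -> R[i]) (z : R[i]) : Prop :=
  (fun t => cmod (u t - z)) @ \oo --> (0 : R).

Definition achievesSSC (ev : op R (tbasis n m) -> nat -> op R (tbasis n m)) : Prop :=
  forall rho0, density rho0 ->
    (fun t => inf [set hsnorm (opsub (ev rho0 t) r) | r in SSC]) @ \oo --> (0 : R).

Definition achievesSavg (ev : op R (tbasis n m) -> nat -> op R (tbasis n m))
  (S : op R (tbasis n m)) : Prop :=
  achievesSSC ev /\
  exists sigma : op R 'I_n, selfadj sigma /\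
    forall rho0, density rho0 -> forall l : 'I_m,
      cvgC (fun t => tr (opmul (loc l sigma) (ev rho0 t))) (tr (opmul S rho0))
   /\ cvgC (fun t => tr (opmul S (ev rho0 t))) (tr (opmul S rho0)).
End Tensor.

(* Main.v *)
(* A word of edges acts on operators as a convex combination of conjugations by
   the U_pi.  Since the graph is connected its transpositions generate the
   symmetric group, so after repeating enough times a word that visits every
   edge, all coefficients are positive; on operators with vanishing group
   average, the word is then a strict contraction for the entrywise l^1 norm,
   which conjugation by U_pi preserves.  In the periodic case such a word
   recurs forever.  In the random case it occurs with positive probability in
   each block of its length, so the expected norm of rho(t) - rho_star tends
   to 0; this bounds the norm of the mean state, and Markov's inequality gives
   (iii).  Finally, Tr(S rho_0) = lim Tr(sigma^(l) rho(t)) =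
   Tr(sigma^(l) rho_star), which equals the trace of rho_0 against the group
   average of sigma^(l), and traces against densities determine an operator. *)
Require Import Defs.
From HB Require Import structures.
From mathcomp Require Import all_boot all_order all_algebra all_fingroup.
From mathcomp Require Import all_classical all_reals all_analysis.
From mathcomp Require Import complex ring.
Import Order.TTheory GRing.Theory Num.Theory.
Import numFieldNormedType.Exports.
Local Open Scope ring_scope.
Local Open Scope complex_scope.
Local Open Scope classical_set_scope.

Set Implicit Arguments. Unset Strict Implicit. Unset Printing Implicit Defensive.

(** * Modulus on the complex numbers *)

Section ComplexModulus.
Variable R : rcfType.
Implicit Types z w : R[i].

Lemma cmodE z : cmod z = complex.ComplexField.Normc.normc z.
Proof. by case: z. Qed.

Lemma cmod0 : cmod (0 : R[i]) = 0.
Proof. by rewrite cmodE complex.ComplexField.Normc.normc0. Qed.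

Lemma cmod_ge0 z : 0 <= cmod z.
Proof. exact: sqrtr_ge0. Qed.

Lemma cmodM z w : cmod (z * w) = cmod z * cmod w.
Proof. by rewrite !cmodE complex.ComplexField.Normc.normcM. Qed.

Lemma cmodD z w : cmod (z + w) <= cmod z + cmod w.
Proof. by rewrite !cmodE le_normcD. Qed.

Lemma cmodN z : cmod (- z) = cmod z.
Proof. by rewrite !cmodE normcN. Qed.

Lemma cmod_real (a : R) : cmod a%:C = `|a|.
Proof. by rewrite /cmod /= expr0n addr0 sqrtr_sqr. Qed.

Lemma cmod_eq0 z : cmod z = 0 -> z = 0.
Proof. by rewrite cmodE => /complex.ComplexField.Normc.eq0_normc. Qed.

Lemma Re_le_cmod z : complex.Re z <= cmod z.
Proof.
rewrite (le_trans (ler_norm _))// -sqrtr_sqr ler_wsqrtr//.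
by rewrite lerDl sqr_ge0.
Qed.

Lemma cmod_sum (I : finType) (P : pred I) (F : I -> R[i]) :
  cmod (\sum_(i | P i) F i) <= \sum_(i | P i) cmod (F i).
Proof.
elim/big_ind2: _ => [|a x b y ax by_|//]; first by rewrite cmod0.
by rewrite (le_trans (cmodD _ _))// lerD.
Qed.

End ComplexModulus.

(** * Entrywise norms of operators *)

Section Norms.
Variables (R : rcfType) (X : finType).
Implicit Types A B : op R X.

Definition norm1 A : R := \sum_x \sum_y cmod (A x y).

Lemma norm1_ge0 A : 0 <= norm1 A.
Proof. by apply: sumr_ge0 => x _; apply: sumr_ge0 => y _; exact: cmod_ge0. Qed.

Lemma cmod_le_norm1 A x y : cmod (A x y) <= norm1 A.
Proof.
rewrite /norm1 (bigD1 x)//= (bigD1 y)//= -addrA lerDl addr_ge0//.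
  by apply: sumr_ge0 => i _; exact: cmod_ge0.
by apply: sumr_ge0 => i _; apply: sumr_ge0 => j _; exact: cmod_ge0.
Qed.

Lemma norm1_comb (I : finType) (P : pred I) (c : I -> R) (F : I -> op R X) :
  (forall i, P i -> 0 <= c i) ->
  norm1 (fun x y => \sum_(i | P i) (c i)%:C * F i x y) <=
  \sum_(i | P i) c i * norm1 (F i).
Proof.
move=> c0; apply: (@le_trans _ _
  (\sum_x \sum_y \sum_(i | P i) c i * cmod (F i x y))).
  apply: ler_sum => x _; apply: ler_sum => y _.
  rewrite (le_trans (cmod_sum _ _))//; apply: ler_sum => i Pi.
  by rewrite cmodM cmod_real ger0_norm ?c0.
rewrite le_eqVlt; apply/orP; left; apply/eqP.
under eq_bigr do rewrite exchange_big/=.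
rewrite exchange_big/=; apply: eq_bigr => i _.
by rewrite /norm1 mulr_sumr; apply: eq_bigr => x _; rewrite mulr_sumr.
Qed.

Lemma hsnormE A : hsnorm A = Num.sqrt (\sum_x \sum_y cmod (A x y) ^+ 2).
Proof.
rewrite /hsnorm; congr Num.sqrt; apply: eq_bigr => x _; apply: eq_bigr => y _.
by rewrite sqr_sqrtr// addr_ge0 ?sqr_ge0.
Qed.

Lemma hsnorm_ge0 A : 0 <= hsnorm A.
Proof. exact: sqrtr_ge0. Qed.

(** In each squared entry one factor is bounded by the whole l^1 norm. Estimates made in [norm1]
    pass to [hsnorm] this way. *)
Lemma hsnorm_le_norm1 A : hsnorm A <= norm1 A.
Proof.
rewrite hsnormE -(ger0_norm (norm1_ge0 A)) -sqrtr_sqr ler_wsqrtr//.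
rewrite expr2 {2}/norm1 mulr_sumr; apply: ler_sum => x _.
rewrite mulr_sumr; apply: ler_sum => y _.
by rewrite expr2 ler_wpM2r ?cmod_ge0// cmod_le_norm1.
Qed.

Lemma cmod_le_hsnorm A x y : cmod (A x y) <= hsnorm A.
Proof.
rewrite hsnormE -[leLHS]ger0_norm ?cmod_ge0// -sqrtr_sqr ler_wsqrtr//.
rewrite (bigD1 x)//= (bigD1 y)//= -addrA lerDl addr_ge0//.
  by apply: sumr_ge0 => i _; exact: sqr_ge0.
by apply: sumr_ge0 => i _; apply: sumr_ge0 => j _; exact: sqr_ge0.
Qed.

(** A crude Hölder bound: every entry of [B] is at most its Hilbert-Schmidt norm. It makes trace
    functionals continuous and controls Tr(D^2) in (iii). *)
Lemma cmod_tr_mul A B : cmod (tr (opmul A B)) <= norm1 A * hsnorm B.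
Proof.
rewrite /tr /opmul (le_trans (cmod_sum _ _))// /norm1 mulr_suml.
apply: ler_sum => x _; rewrite (le_trans (cmod_sum _ _))// mulr_suml.
apply: ler_sum => y _.
by rewrite cmodM ler_wpM2l ?cmod_ge0 ?cmod_le_hsnorm.
Qed.

Lemma trB A B C : tr (opmul A (opsub B C)) = tr (opmul A B) - tr (opmul A C).
Proof.
rewrite /tr /opmul -sumrB; apply: eq_bigr => x _.
by rewrite -sumrB; apply: eq_bigr => y _; rewrite mulrBr.
Qed.

End Norms.

(** * Conjugation by permutations and the group average *)

Section PermutationAction.
Variables (R : realType) (n m : nat).
Local Notation G := {perm 'I_m}.
Local Notation T := (tbasis n m).
Implicit Types (A B : op R T) (g s : G) (x y : T).

Definition relabel g x : T := [ffun i => x (g^-1 i)%g].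

Lemma relabelM g s x : relabel g (relabel s x) = relabel (s * g)%g x.
Proof. by apply/ffunP => i; rewrite !ffunE invMg permM. Qed.

Lemma relabel1 x : relabel 1%g x = x.
Proof. by apply/ffunP => i; rewrite ffunE invg1 perm1. Qed.

Lemma relabelK g : cancel (relabel g) (relabel g^-1%g).
Proof. by move=> x; rewrite relabelM mulgV relabel1. Qed.

Lemma relabelVK g : cancel (relabel g^-1%g) (relabel g).
Proof. by move=> x; rewrite relabelM mulVg relabel1. Qed.

Lemma relabel_bij g : bijective (relabel g).
Proof. by exists (relabel g^-1%g); [exact: relabelK|exact: relabelVK]. Qed.

Definition permute g A : op R T := fun x y => A (relabel g x) (relabel g y).

(** Each row of [Uperm] has a single nonzero entry, so both sums over intermediate basis vectors
    collapse. *)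
Lemma conjU_Uperm g A : conjU (Uperm R g) A = permute g A.
Proof.
apply/funext => x; apply/funext => y.
rewrite /conjU /opmul /adj /Uperm /permute.
rewrite (bigD1 (relabel g y))//= [X in _ + X]big1 ?addr0; last first.
  by move=> z /negbTE zy; rewrite -/(relabel g y) zy conjc0 mulr0.
rewrite -/(relabel g y) eqxx conjc1 mulr1.
rewrite (bigD1 (relabel g x))//= [X in _ + X]big1 ?addr0; last first.
  by move=> z /negbTE zx; rewrite -/(relabel g x) zx mul0r.
by rewrite -/(relabel g x) eqxx mul1r.
Qed.

Lemma permuteM g s A : permute g (permute s A) = permute (g * s)%g A.
Proof. by apply/funext => x; apply/funext => y; rewrite /permute !relabelM. Qed.

Lemma permute1 A : permute 1%g A = A.
Proof. by apply/funext => x; apply/funext => y; rewrite /permute !relabel1. Qed.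

Lemma sum_relabel (V : nmodType) g (F : T -> V) :
  \sum_x F (relabel g x) = \sum_x F x.
Proof. by rewrite [RHS](reindex _ (onW_bij _ (relabel_bij g))). Qed.

Lemma sum2_relabel (V : nmodType) g (F : T -> T -> V) :
  \sum_x \sum_y F (relabel g x) (relabel g y) = \sum_x \sum_y F x y.
Proof.
by rewrite -[RHS](sum_relabel g); apply: eq_bigr => x _; exact: sum_relabel.
Qed.

Lemma norm1_permute g A : norm1 (permute g A) = norm1 A.
Proof. exact: (sum2_relabel g (fun x y => cmod (A x y))). Qed.

Lemma rhostarE A x y :
  rhostar A x y = ((m`!)%:R^-1 : R)%:C * \sum_g permute g A x y.
Proof.
rewrite /rhostar fmorphV rmorph_nat; congr (_ * _).
by apply: eq_bigr => g _; rewrite conjU_Uperm.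
Qed.

Lemma sum_permute A x y : \sum_g permute g A x y = (m`!)%:R * rhostar A x y.
Proof.
by rewrite rhostarE fmorphV rmorph_nat mulVKf// pnatr_eq0 -lt0n fact_gt0.
Qed.

Lemma permute_rhostar g A : permute g (rhostar A) = rhostar A.
Proof.
apply/funext => x; apply/funext => y; rewrite {1}/permute !rhostarE.
congr (_ * _); rewrite [RHS](reindex_inj (mulgI g))/=.
by apply: eq_bigr => s _; rewrite -permuteM.
Qed.

Lemma rhostar_id A : (forall g, permute g A = A) -> rhostar A = A.
Proof.
move=> AG; apply/funext => x; apply/funext => y; rewrite rhostarE.
under eq_bigr do rewrite AG.
rewrite sumr_const card_Sn -[A x y *+ _]mulr_natl mulrA fmorphV rmorph_nat.
by rewrite mulVf ?mul1r// pnatr_eq0 -lt0n fact_gt0.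
Qed.

Lemma rhostarB A B : rhostar (opsub A B) = opsub (rhostar A) (rhostar B).
Proof.
apply/funext => x; apply/funext => y.
by rewrite /opsub !rhostarE -mulrBr -sumrB.
Qed.

(** Puts every deviation from the average in the kernel of [rhostar], the subspace on which covering
    words contract. *)
Lemma rhostar_sub_rhostar A : rhostar (opsub A (rhostar A)) = fun _ _ => 0.
Proof.
rewrite rhostarB (rhostar_id (fun g => permute_rhostar g A)).
by apply/funext => x; apply/funext => y; rewrite /opsub subrr.
Qed.

Lemma tr_mul_permute g A B :
  tr (opmul A (permute g B)) = tr (opmul (permute g^-1%g A) B).
Proof.
rewrite /tr /opmul [RHS](reindex _ (onW_bij _ (relabel_bij g))).
apply: eq_bigr => x _; rewrite [RHS](reindex _ (onW_bij _ (relabel_bij g))).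
by apply: eq_bigr => y _; rewrite /permute !relabelK.
Qed.

(** Moves the average from the state to the observable: under the trace pairing the transpose of
    [permute g] is [permute g^-1], and inversion permutes the group. *)
Lemma tr_mul_rhostar A B : tr (opmul A (rhostar B)) = tr (opmul (rhostar A) B).
Proof.
transitivity (((m`!)%:R^-1 : R)%:C * \sum_g tr (opmul A (permute g B))).
  rewrite /tr /opmul mulr_sumr.
  under [RHS]eq_bigr do rewrite mulr_sumr.
  rewrite [RHS]exchange_big; apply: eq_bigr => x _ /=.
  under [RHS]eq_bigr do rewrite mulr_sumr.
  rewrite [RHS]exchange_big; apply: eq_bigr => y _ /=.
  rewrite rhostarE mulr_sumr mulr_sumr; apply: eq_bigr => g _.
  by rewrite mulrCA.
rewrite mulr_sumr [in RHS]/tr [in RHS]/opmul.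
under [RHS]eq_bigr do under eq_bigr do rewrite rhostarE mulr_sumr mulr_suml.
rewrite (reindex_inj invg_inj).
under [RHS]eq_bigr do rewrite exchange_big/=.
rewrite [RHS]exchange_big; apply: eq_bigr => g _ /=.
rewrite tr_mul_permute invgK /tr /opmul mulr_sumr; apply: eq_bigr => x _.
by rewrite mulr_sumr; apply: eq_bigr => y _; rewrite mulrA.
Qed.

Lemma rhostar_density A : density A -> density (rhostar A).
Proof.
have m0 : 0 <= ((m`!)%:R^-1 : R) by rewrite invr_ge0 ler0n.
case=> Asa Apos Atr; split.
- apply/funext => x; apply/funext => y; rewrite /adj !rhostarE.
  rewrite rmorphM [X in X * _]conjc_real rmorph_sum; congr (_ * _); apply: eq_bigr => g _.
  by rewrite /permute -{2}Asa.
- move=> v.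
  have -> : \sum_x \sum_y (v x)^*%C * rhostar A x y * v y =
      ((m`!)%:R^-1 : R)%:C *
      \sum_g \sum_x \sum_y (v x)^*%C * permute g A x y * v y.
    rewrite [in RHS]exchange_big mulr_sumr; apply: eq_bigr => x _ /=.
    rewrite [in RHS]exchange_big mulr_sumr; apply: eq_bigr => y _ /=.
    by rewrite rhostarE -mulr_suml -mulr_sumr mulrCA !mulrA.
  rewrite mulr_ge0 ?ler0c//; apply: sumr_ge0 => g _.
  (* The quadratic form of a conjugate of [A] at [v] is that of [A] at the transported vector. *)
  have := Apos (v \o relabel g^-1%g).
  congr (_ <= _); rewrite -(sum2_relabel g); apply: eq_bigr => x _.
  by apply: eq_bigr => y _; rewrite /= !relabelK.
- rewrite /tr.
  under eq_bigr do rewrite rhostarE.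
  rewrite -mulr_sumr exchange_big/=.
  under eq_bigr do rewrite (sum_relabel _ (fun x => A x x)) -/(tr A) Atr.
  rewrite sumr_const card_Sn fmorphV rmorph_nat.
  by rewrite mulVf// pnatr_eq0 -lt0n fact_gt0.
Qed.

Lemma SSC_rhostar A : density A -> SSC (rhostar A).
Proof.
move=> dA; split; first exact: rhostar_density.
by move=> s; rewrite conjU_Uperm permute_rhostar.
Qed.

End PermutationAction.

Lemma sum_mulg (V : nmodType) (gT : finGroupType) (s : gT) (F : gT -> V) :
  \sum_g F (g * s)%g = \sum_g F g.
Proof. by rewrite [RHS](reindex_inj (mulIg s)). Qed.

(** * Words of gossip steps as random products of transpositions *)

Section Gossip.
Variables (R : realType) (n m : nat) (alpha : R).
Local Notation G := {perm 'I_m}.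
Local Notation T := (tbasis n m).
Implicit Types (A B : op R T) (e : 'I_m * 'I_m) (w v : seq ('I_m * 'I_m)).

Lemma gossipE e A x y :
  gossip alpha e A x y =
  (1 - alpha)%:C * A x y + alpha%:C * permute (tperm e.1 e.2) A x y.
Proof. by rewrite /gossip conjU_Uperm. Qed.

Lemma gossipB e A B :
  gossip alpha e (opsub A B) = opsub (gossip alpha e A) (gossip alpha e B).
Proof.
apply/funext => x; apply/funext => y.
by rewrite /opsub !gossipE /permute !mulrBr opprD addrACA.
Qed.

Lemma gossip_rhostar e A : gossip alpha e (rhostar A) = rhostar A.
Proof.
apply/funext => x; apply/funext => y.
by rewrite gossipE permute_rhostar -mulrDl -rmorphD subrK rmorph1 mul1r.
Qed.

Lemma evol_word_cat w v A :
  evol_word alpha (w ++ v) A = evol_word alpha v (evol_word alpha w A).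
Proof. exact: foldl_cat. Qed.

Lemma evol_word_sub_rhostar w A :
  opsub (evol_word alpha w A) (rhostar A) =
  evol_word alpha w (opsub A (rhostar A)).
Proof.
(* The subtracted average is frozen under a new name, so that the induction may change [A] while the
   fixed point stays. *)
have [B BE] : exists B, rhostar A = rhostar B by exists A.
rewrite BE; elim: w A {BE} => [//|e w IH] A.
by rewrite /= -/(evol_word _ _ _) IH gossipB gossip_rhostar.
Qed.

(** Right translation by a transposition permutes the group. Hence the kernel of [rhostar] is
    stable, which allows contractions to be iterated. *)
Lemma rhostar_gossip e A : rhostar (gossip alpha e A) = rhostar A.
Proof.
apply/funext => x; apply/funext => y; rewrite !rhostarE; congr (_ * _).
transitivity (\sum_g ((1 - alpha)%:C * permute g A x y +
    alpha%:C * permute (g * tperm e.1 e.2)%g A x y)).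
  by apply: eq_bigr => g _; rewrite -permuteM /permute gossipE.
rewrite big_split/= -!mulr_sumr.
rewrite (sum_mulg _ (fun g => permute g A x y)).
by rewrite -mulrDl -rmorphD subrK rmorph1 mul1r.
Qed.

Lemma rhostar_evol_word w A : rhostar (evol_word alpha w A) = rhostar A.
Proof.
elim: w A => [//|e w IH] A.
by rewrite /= -/(evol_word _ _ _) IH rhostar_gossip.
Qed.

(* The law on permutations of the random product of transpositions in which
   each letter of [w] is used with probability [alpha]. *)
Fixpoint weight w (g : G) : R :=
  if w is e :: w' then
    (1 - alpha) * weight w' g + alpha * weight w' (g * tperm e.1 e.2)%g
  else (g == 1%g)%:R.

Lemma evol_wordE w A x y :
  evol_word alpha w A x y = \sum_g (weight w g)%:C * permute g A x y.
Proof.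
elim: w A x y => [|e w IH] A x y.
  rewrite (bigD1 1%g)//= eqxx rmorph1 mul1r permute1 big1 ?addr0// => g g1.
  by rewrite (negbTE g1) rmorph0 mul0r.
rewrite /= -/(evol_word _ _ _) IH.
transitivity (\sum_g (((1 - alpha) * weight w g)%:C * permute g A x y +
   (alpha * weight w g)%:C * permute (g * tperm e.1 e.2)%g A x y)).
  apply: eq_bigr => g _; rewrite -permuteM /permute gossipE /permute.
  by rewrite mulrDr !rmorphM !mulrA ![_%:C * (weight w g)%:C]mulrC.
(* The transposition is an involution, so translating the second sum by it brings the swapped term
   back to index [g]. *)
rewrite big_split/= addrC (reindex_inj (mulIg (tperm e.1 e.2)))/= addrC.
rewrite -big_split; apply: eq_bigr => g _ /=.
by rewrite -mulgA tperm2 mulg1 -mulrDl -rmorphD.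
Qed.

Lemma sum_weight w : \sum_g weight w g = 1.
Proof.
elim: w => [|e w IH] /=.
  by rewrite (bigD1 1%g)//= eqxx big1 ?addr0// => g /negbTE ->.
rewrite big_split/= -!mulr_sumr.
rewrite (sum_mulg _ (weight w)).
by rewrite IH !mulr1 subrK.
Qed.

(** Products of subwords of [w], last letter first; [weight] is positive on them. With subset
    products, repeating a word becomes taking a power of a set. *)
Fixpoint reachable w : {set G} :=
  if w is e :: w' then (reachable w' * [set 1; tperm e.1 e.2]%SET)%g else 1%g.

Lemma reachable_cat w v : reachable (w ++ v) = (reachable v * reachable w)%g.
Proof. by elim: w => [|e w IH] /=; rewrite ?mulg1// IH mulgA. Qed.

Lemma reachable_nseq k w :
  reachable (flatten (nseq k w)) = (reachable w ^+ k)%g.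
Proof. by elim: k => [|k IH]//=; rewrite reachable_cat IH expgSr. Qed.

Lemma reachable1 w : 1%g \in reachable w.
Proof.
elim: w => [|e w IH] /=; first by rewrite inE.
by rewrite -{1}[1%g]mulg1 mem_mulg// !inE eqxx.
Qed.

Lemma reachable_tperm w e : e \in w -> tperm e.1 e.2 \in reachable w.
Proof.
elim: w => [//|f w IH] /=; rewrite inE => /orP[/eqP <-|/IH ew].
  by rewrite -{1}[tperm _ _]mul1g mem_mulg ?reachable1// !inE eqxx orbT.
by rewrite -{1}[tperm _ _]mulg1 mem_mulg// !inE eqxx.
Qed.

Hypothesis alpha01 : 0 < alpha < 1.
Let alpha_gt0 : 0 < alpha. Proof. by case/andP: alpha01. Qed.
Let alphaC_gt0 : 0 < 1 - alpha.
Proof. by rewrite subr_gt0; case/andP: alpha01. Qed.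

Lemma weight_ge0 w g : 0 <= weight w g.
Proof.
elim: w g => [|e w IH] g /=; first exact: ler0n.
by rewrite addr_ge0// mulr_ge0// ltW.
Qed.

Lemma weight_gt0 w g : g \in reachable w -> 0 < weight w g.
Proof.
elim: w g => [|e w IH] g /=; first by rewrite inE => /eqP ->; rewrite eqxx.
case/mulsgP => h s hw; rewrite !inE => /orP[]/eqP -> ->.
  rewrite mulg1 ltr_wpDr ?mulr_gt0 ?IH//.
  by rewrite mulr_ge0 ?weight_ge0// ltW.
rewrite -mulgA tperm2 mulg1 ltr_wpDl ?mulr_gt0 ?IH//.
by rewrite mulr_ge0 ?weight_ge0// ltW.
Qed.

Lemma norm1_evol_word w A : norm1 (evol_word alpha w A) <= norm1 A.
Proof.
have -> : evol_word alpha w A =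
    fun x y => \sum_g (weight w g)%:C * permute g A x y.
  by apply/funext => x; apply/funext => y; exact: evol_wordE.
rewrite (le_trans (norm1_comb _ _))//.
  by move=> g _; exact: weight_ge0.
under eq_bigr do rewrite norm1_permute.
by rewrite -mulr_suml sum_weight mul1r.
Qed.

(* Doeblin's argument: on the kernel of [rhostar] the common part [c] of all
   weights acts as zero, which removes a mass [c * m!] from the average. *)
Lemma evol_word_contraction w : (forall g, 0 < weight w g) ->
  exists2 k : R, 0 <= k < 1 & forall A, rhostar A = (fun _ _ => 0) ->
    norm1 (evol_word alpha w A) <= k * norm1 A.
Proof.
move=> w0; pose g0 := [arg min_(g < 1%g : G) weight w g]%O.
have g0P g : weight w g0 <= weight w g.
  by rewrite /g0; case: arg_minP => // i _ H; exact: H.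
have kE : \sum_g (weight w g - weight w g0) = 1 - weight w g0 *+ m`!.
  by rewrite sumrB sum_weight sumr_const card_Sn.
exists (1 - weight w g0 *+ m`!).
  apply/andP; split; first by rewrite -kE sumr_ge0// => g _; rewrite subr_ge0.
  by rewrite ltrBlDr ltrDl pmulrn_lgt0 ?fact_gt0.
move=> A A0.
have -> : evol_word alpha w A =
    fun x y => \sum_g (weight w g - weight w g0)%:C * permute g A x y.
  apply/funext => x; apply/funext => y; rewrite evol_wordE.
  under [RHS]eq_bigr do rewrite rmorphB mulrBl.
  by rewrite sumrB -mulr_sumr sum_permute A0 !mulr0 subr0.
rewrite (le_trans (norm1_comb _ _))//.
  by move=> g _; rewrite subr_ge0.
under eq_bigr do rewrite norm1_permute.
by rewrite -mulr_suml kE.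
Qed.

End Gossip.

(** * Transpositions along a connected graph generate the symmetric group *)

Section Connectivity.
Variables (m : nat) (E : {set 'I_m * 'I_m}).
Hypothesis m_gt0 : (0 < m)%N.
Hypothesis E_conn : forall j k : 'I_m,
  connect (fun a b : 'I_m => ((a, b) \in E) || ((b, a) \in E)) j k.

(** Connectivity yields every transposition by conjugation along a path, and the transpositions
    moving one fixed point already generate. *)
Lemma gen_edge_tperm :
  <<[set tperm e.1 e.2 | e in E]%SET>>%g = [set: {perm 'I_m}]%SET.
Proof.
set H := <<_>>%g.
have edge a b : ((a, b) \in E) || ((b, a) \in E) -> tperm a b \in H.
  case/orP => abE; last rewrite tpermC.
    by apply/mem_gen/imsetP; exists (a, b).
  by apply/mem_gen/imsetP; exists (b, a).
have tH a b : tperm a b \in H.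
  have /connectP[p] := E_conn a b.
  elim/last_ind: p b => [|p c IH] b; first by move=> _ ->; rewrite tperm1.
  rewrite rcons_path last_rcons => /andP[ap pc] ->.
  have [->|nac] := eqVneq a c; first by rewrite tperm1.
  have {IH}alH := IH _ ap erefl.
  have [lc|nlc] := eqVneq (last a p) c; first by rewrite -lc.
  (* Conjugating the last edge of the path by the transposition of [a] with the previous vertex
     gives the transposition of [a] and [c]. *)
  rewrite -(tpermJ_tperm nlc nac).
  by apply: groupJ; [exact: edge|rewrite tpermC].
apply/eqP; rewrite finset.eqEsubset finset.subsetT/= -(gen_tperm (Ordinal m_gt0)).
rewrite gen_subG; apply/fintype.subsetP => _ /imsetP[b _ ->]; exact: tH.
Qed.

(** A finite generated group is some power of the generating set with 1 adjoined, and [reachable w]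
    contains that set. *)
Lemma reachable_full w : {subset E <= w} ->
  exists K, reachable (flatten (nseq K.+1 w)) = [set: {perm 'I_m}]%SET.
Proof.
move=> Ew; have [K KE] := gen_expgs [set tperm e.1 e.2 | e in E]%SET.
have sub : 1%g |: [set tperm e.1 e.2 | e in E]%SET \subset reachable w.
  rewrite finset.subUset finset.sub1set reachable1/=.
  by apply/fintype.subsetP => _ /imsetP[e /Ew ew ->]; exact: reachable_tperm.
exists K; apply/eqP; rewrite reachable_nseq finset.eqEsubset finset.subsetT/=.
rewrite -gen_edge_tperm KE expgSr -[((_ |: _) ^+ K)%g]mulg1.
(* The extra repetition loses nothing, because 1 is reachable. *)
rewrite mulgSS ?finset.sub1set ?reachable1//.
elim: (K) => [|k IH]; first by rewrite !expg0.
by rewrite !expgSr mulgSS.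
Qed.

End Connectivity.

(** * Limits of real sequences that decay geometrically along blocks *)

Section GeometricLimit.
Variable R : realType.

(** The decay is known only at multiples of the block length [B]; monotonicity covers the times in
    between. *)
Lemma nonincreasing_cvg0 (u : nat -> R) (B : nat) (k C : R) :
  (forall t, 0 <= u t) -> (forall t, u t.+1 <= u t) -> 0 <= k < 1 ->
  (forall j, u (j * B)%N <= k ^+ j * C) -> u @ \oo --> (0 : R).
Proof.
move=> u0 uS /andP[k0 k1] uB.
have kC : (fun j => k ^+ j * C) @ \oo --> (0 : R).
  rewrite -[0](mul0r C); apply: cvgM; last exact: cvg_cst.
  by apply: cvg_expr; rewrite ger0_norm.
have un : nonincreasing_seq u by apply/nonincreasing_seqP.
apply/cvgrPdist_lt => eps eps0.
move/cvgrPdist_lt: kC => /(_ eps eps0)[J _ /(_ J (leqnn J)) HJ].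
exists (J * B)%N => // t /= Jt; rewrite sub0r normrN ger0_norm//.
apply: le_lt_trans (un _ _ Jt) (le_lt_trans (uB J) _).
by move: HJ; rewrite /= sub0r normrN; exact: le_lt_trans (ler_norm _).
Qed.

Lemma squeeze_cvg0 (u v : nat -> R) :
  (forall t, 0 <= u t <= v t) -> v @ \oo --> (0 : R) -> u @ \oo --> (0 : R).
Proof.
move=> uv; apply: squeeze_cvgr; last exact: cvg_cst.
exact: nearW.
Qed.

End GeometricLimit.

(** * Expectations over words of independent letters *)

Section RandomWord.
Variables (R : realType) (D : finType) (E : {set D}) (q : D -> R).
Implicit Types (F H : seq D -> R) (w : seq D).

(** The expectation of [F] at the first [k] letters of an i.i.d. sequence of law [q] on [E]: the sum
    in [prob_word] with [F] in place of an indicator. *)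
Definition mean_word k F : R :=
  \sum_(w : k.-tuple D | all (mem E) w) (\prod_(e <- w) q e) * F w.

Lemma mean_word0 F : mean_word 0 F = F [::].
Proof.
rewrite /mean_word (big_pred1 [tuple])/= ?big_nil ?mul1r// => w.
by rewrite tuple0; apply/esym/eqP.
Qed.

Lemma mean_wordS k F :
  mean_word k.+1 F = \sum_(e in E) q e * mean_word k (fun w => F (e :: w)).
Proof.
rewrite /mean_word (reindex (fun p : D * k.-tuple D => cons_tuple p.1 p.2)).
  under [RHS]eq_bigr do rewrite mulr_sumr.
  rewrite pair_big/=; apply: eq_bigr => -[e w] _ /=.
  by rewrite big_cons mulrA.
exists (fun w : k.+1.-tuple D => (thead w, behead_tuple w)) => [[e w] _|w _] /=.
  by congr pair; apply: val_inj.
by rewrite [RHS]tuple_eta; apply: val_inj.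
Qed.

Hypothesis q_gt0 : forall e, e \in E -> 0 < q e.
Hypothesis q_sum1 : \sum_(e in E) q e = 1.

Lemma prob_gt0 w : all (mem E) w -> 0 < \prod_(e <- w) q e.
Proof.
elim: w => [|e w IH] /=; first by rewrite big_nil.
by case/andP=> eE wE; rewrite big_cons mulr_gt0 ?q_gt0 ?IH.
Qed.

Lemma le_mean_word k F H : (forall w, all (mem E) w -> F w <= H w) ->
  mean_word k F <= mean_word k H.
Proof.
move=> FH; apply: ler_sum => w wE.
by rewrite ler_wpM2l ?FH// ltW// prob_gt0.
Qed.

Lemma mean_word_cst k (c : R) : mean_word k (fun=> c) = c.
Proof.
elim: k => [|k IH]; first exact: mean_word0.
by rewrite mean_wordS IH -mulr_suml q_sum1 mul1r.
Qed.

Lemma mean_wordM k F (c : R) :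
  mean_word k (fun w => c * F w) = c * mean_word k F.
Proof.
by rewrite /mean_word mulr_sumr; apply: eq_bigr => w _; rewrite mulrCA.
Qed.

Lemma mean_word_ge0 k F : (forall w, all (mem E) w -> 0 <= F w) ->
  0 <= mean_word k F.
Proof. by rewrite -{2}(mean_word_cst k 0); exact: le_mean_word. Qed.

(** Independence of consecutive blocks, by conditioning on one letter at a time. *)
Lemma mean_word_cat k l F :
  mean_word (k + l) F = mean_word k (fun w => mean_word l (fun v => F (w ++ v))).
Proof.
elim: k F => [|k IH] F; first by rewrite mean_word0.
by rewrite addSn !mean_wordS; apply: eq_bigr => e _; rewrite IH.
Qed.

(** With probability p the block drawn is [w], where the bound is kC; on the remaining mass 1 - p
    the bound is C. *)
Lemma mean_word_contraction F w (k C : R) : all (mem E) w -> k < 1 ->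
  0 <= C -> (forall v, all (mem E) v -> F v <= C) -> F w <= k * C ->
  mean_word (size w) F <= (1 - (1 - k) * \prod_(e <- w) q e) * C.
Proof.
move=> wE k1 C0 FC Fw; set p := \prod_(e <- w) q e.
rewrite /mean_word (bigD1 (in_tuple w))//= -/p.
have : mean_word (size w) (fun=> C) = C by exact: mean_word_cst.
rewrite /mean_word (bigD1 (in_tuple w))//= -/p => pC.
have -> : (1 - (1 - k) * p) * C = p * (k * C) + (C - p * C) by ring.
rewrite lerD ?ler_wpM2l ?(ltW (prob_gt0 wE))//.
rewrite -[X in _ <= X - _]pC [leRHS]addrC addKr; apply: ler_sum => v /andP[vE _].
by rewrite ler_wpM2l ?FC// ltW// prob_gt0.
Qed.

Lemma prob_le1 w : all (mem E) w -> \prod_(e <- w) q e <= 1.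
Proof.
move=> wE; rewrite -[leRHS](mean_word_cst (size w)) /mean_word.
rewrite (bigD1 (in_tuple w))//= mulr1 lerDl; apply: sumr_ge0 => v /andP[vE _].
by rewrite mulr1 ltW// prob_gt0.
Qed.

End RandomWord.

Lemma markov_word (R : realType) m (E : {set 'I_m * 'I_m}) q k
    (P : pred (seq ('I_m * 'I_m))) F (eps : R) :
  (forall e, e \in E -> 0 < q e) -> 0 < eps ->
  (forall w, all (mem E) w -> 0 <= F w) ->
  (forall w, P w -> eps <= F w) ->
  prob_word E q k P <= eps^-1 * mean_word E q k F.
Proof.
move=> q0 e0 F0 PF; rewrite /prob_word /mean_word mulr_sumr big_mkcondr.
apply: ler_sum => w wE; have p0 := ltW (prob_gt0 q0 wE).
case: ifPn => Pw; last by rewrite mulr_ge0 ?invr_ge0 ?(ltW e0)// mulr_ge0 ?F0.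
by rewrite mulrCA ler_peMr// mulrC ler_pdivlMr// mul1r PF.
Qed.

Lemma conjcM (R : rcfType) (z w : R[i]) : (z * w)^*%C = z^*%C * w^*%C.
Proof. exact: rmorphM. Qed.

Lemma conjcD (R : rcfType) (z w : R[i]) : (z + w)^*%C = z^*%C + w^*%C.
Proof. exact: rmorphD. Qed.

Lemma conjc_sum (R : rcfType) (I : finType) (F : I -> R[i]) :
  (\sum_i F i)^*%C = \sum_i (F i)^*%C.
Proof. exact: rmorph_sum. Qed.

(** * Traces against density operators separate operators *)

Section Densities.
Variables (R : rcfType) (X : finType).
Implicit Types (A B : op R X) (v : X -> R[i]).

(** The projector onto the line of [v], normalised here so that [v] need not be a unit vector. *)
Definition pure v : op R X :=
  fun x y => (\sum_z v z * (v z)^*%C)^-1 * (v x * (v y)^*%C).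

Lemma density_pure v : \sum_z v z * (v z)^*%C != 0 -> density (pure v).
Proof.
rewrite /pure; set N := \sum_z _ => N0.
have NJ : N^*%C = N.
  rewrite /N conjc_sum; apply: eq_bigr => z _.
  by rewrite conjcM conjcK mulrC.
split.
- apply/funext => x; apply/funext => y; rewrite /adj !conjcM.
  by rewrite conjc_inv NJ conjcK [_ * v x]mulrC.
- move=> u.
  have -> : \sum_x \sum_y (u x)^*%C * (N^-1 * (v x * (v y)^*%C)) * u y =
      N^-1 * ((\sum_x (u x)^*%C * v x) * (\sum_x (u x)^*%C * v x)^*%C).
    rewrite conjc_sum mulr_suml mulr_sumr; apply: eq_bigr => x _ /=.
    rewrite mulr_sumr mulr_sumr; apply: eq_bigr => y _.
    by rewrite conjcM conjcK; ring.
  apply: mulr_ge0; last exact: mulcJ_ge0.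
  by rewrite invr_ge0; apply: sumr_ge0 => z _; exact: mulcJ_ge0.
- by rewrite /tr -mulr_sumr mulVf.
Qed.

Definition pairv (a b : X) (c : R[i]) : X -> R[i] :=
  fun x => (x == a)%:R + c * (x == b)%:R.

Lemma sum_pairv a b c (F : X -> R[i]) :
  \sum_x F x * pairv a b c x = F a + F b * c.
Proof.
rewrite /pairv; under eq_bigr do rewrite mulrDr.
rewrite big_split/= (bigD1 a)//= eqxx mulr1 big1 ?addr0 => [|x /negbTE ->].
  rewrite (bigD1 b)//= eqxx mulr1 big1 ?addr0// => x /negbTE ->.
  by rewrite mulr0 mulr0.
by rewrite mulr0.
Qed.

Lemma sum_conj_pairv a b c (F : X -> R[i]) :
  \sum_x F x * (pairv a b c x)^*%C = F a + F b * c^*%C.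
Proof.
rewrite -sum_pairv; apply: eq_bigr => x _.
by rewrite /pairv conjcD conjcM !conjc_nat.
Qed.

Lemma tr_mul_pairv A a b c :
  tr (opmul A (pure (pairv a b c))) =
  (\sum_z pairv a b c z * (pairv a b c z)^*%C)^-1 *
  (A a a + A a b * c + (A b a + A b b * c) * c^*%C).
Proof.
rewrite -!sum_pairv -(sum_conj_pairv a b c (fun x => \sum_y A x y * _)).
rewrite /tr /opmul mulr_sumr; apply: eq_bigr => x _.
rewrite mulr_suml mulr_sumr; apply: eq_bigr => y _.
by rewrite /pure; ring.
Qed.

(** Polarization with the pure states of |a> + c|b>: c = 0 gives the diagonal, c = 1 and c = i the
    sum and the difference of opposite off-diagonal entries. *)
Lemma op_eq_density A B :
  (forall r, density r -> tr (opmul A r) = tr (opmul B r)) -> A = B.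
Proof.
move=> AB.
have key a b c : pairv a b c a + pairv a b c b * c^*%C != 0 ->
    A a a + A a b * c + (A b a + A b b * c) * c^*%C =
    B a a + B a b * c + (B b a + B b b * c) * c^*%C.
  rewrite -sum_conj_pairv => N0.
  have := AB _ (density_pure N0); rewrite !tr_mul_pairv.
  by apply: mulfI; rewrite invr_eq0.
have diag a : A a a = B a a.
  have := key a a 0; rewrite /pairv eqxx conjc0 !mulr0 !addr0 mul0r addr0.
  by apply; exact: oner_neq0.
apply/funext => a; apply/funext => b.
have [<-//|ab] := eqVneq a b.
have [I [II IJ]] : exists I : R[i], I * I = -1 /\ I^*%C = - I.
  by exists (0 +i* 1)%C; split; simpc.
have va c : pairv a b c a = 1 by rewrite /pairv eqxx (negbTE ab) mulr0 addr0.
have vb c : pairv a b c b = c.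
  by rewrite /pairv eqxx eq_sym (negbTE ab) mulr1 add0r.
(* The squared norm of |a> + c|b> is 2 both for c = 1 and for c = i. *)
have n2 : 1 + 1 != 0 :> R[i] by rewrite (pnatr_eq0 _ 2).
have := key a b I; have := key a b 1.
rewrite !va !vb !diag conjc1 IJ !mulr1 mulrN II opprK => /(_ n2) H1 /(_ n2) H2.
have E1 : A a b + A b a = B a b + B b a.
  by move: H1; rewrite !addrA => /addIr; rewrite -!addrA => /addrI.
have E2 : A a b - A b a = B a b - B b a.
  have I0 : I != 0.
    apply/eqP => I0; move: II; rewrite I0 mul0r => /eqP.
    by rewrite eq_sym oppr_eq0 oner_eq0.
  apply: (mulIf I0).
  have e (x y z t : R[i]) : (y - z) * I =
     x + y * I + (z + t * I) * - I - x + t * (I * I) by ring.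
  by rewrite (e (B a a) (A a b) _ (B b b)) H2 -e.
have : 2%:R * A a b = 2%:R * B a b.
  have e (x y : R[i]) : 2%:R * x = (x + y) + (x - y) by ring.
  by rewrite (e _ (A b a)) E1 E2 -e.
by apply: mulfI; rewrite pnatr_eq0.
Qed.

End Densities.

(** * From convergence to the group average to SSC and S-average SSC *)

Section Consensus.
Variables (R : realType) (n m : nat).
Local Notation T := (tbasis n m).
Implicit Types (A B : op R T) (sigma : op R 'I_n).

Lemma permute_loc g l sigma :
  permute g (loc l sigma) = loc (g^-1 l)%g sigma :> op R T.
Proof.
apply/funext => x; apply/funext => y; rewrite /permute /loc !ffunE.
congr (_ * _); rewrite [RHS](reindex_inj (@perm_inj _ g^-1%g))/=.
by apply: eq_big => [j|j _]; rewrite ?(inj_eq perm_inj)// !ffunE.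
Qed.

(** Double counting over starting positions and permutations: every position has the same group sum,
    and each single permutation merely reorders the m local operators. *)
Lemma rhostar_loc l sigma : rhostar (loc l sigma) = avg_loc sigma :> op R T.
Proof.
have m0 : m%:R != 0 :> R[i] by rewrite pnatr_eq0 -lt0n (leq_ltn_trans _ (ltn_ord l)).
have f0 : (m`!)%:R != 0 :> R[i] by rewrite pnatr_eq0 -lt0n fact_gt0.
apply/funext => x; apply/funext => y.
apply: (mulfI f0); apply: (mulfI m0); rewrite /avg_loc -sum_permute.
rewrite [RHS]mulrCA mulVKf//.
transitivity (\sum_(i < m) \sum_g permute g (loc i sigma) x y).
  rewrite [RHS](eq_bigr (fun=> \sum_g permute g (loc l sigma) x y)) => [|i _].
    by rewrite sumr_const card_ord mulr_natl.
  rewrite -(sum_mulg (tperm i l)); apply: eq_bigr => g _.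
  by rewrite !permute_loc invMg permM tpermV tpermL.
rewrite exchange_big/=.
rewrite [LHS](eq_bigr (fun=> \sum_(i < m) loc i sigma x y)) => [|g _].
  by rewrite sumr_const card_Sn mulr_natl.
rewrite [RHS](reindex_inj (@perm_inj _ g^-1%g))/=.
by apply: eq_bigr => i _; rewrite permute_loc.
Qed.

Lemma cvgC_unique (u : nat -> R[i]) a b : cvgC u a -> cvgC u b -> a = b.
Proof.
move=> ua ub.
have uab : (fun t => cmod (u t - a) + cmod (u t - b)) @ \oo --> (0 : R).
  by rewrite -[0](addr0 0); exact: cvgD.
apply/eqP; rewrite -subr_eq0; apply/eqP/cmod_eq0/eqP.
rewrite eq_le cmod_ge0 andbT.
have c : (fun=> cmod (a - b)) @ \oo --> cmod (a - b) by exact: cvg_cst.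
apply: (ler_cvg_to c uab); apply: nearW => t /=.
rewrite (_ : a - b = - (u t - a) + (u t - b)); last by ring.
by rewrite (le_trans (cmodD _ _))// cmodN.
Qed.

Lemma cvgC_tr (u : nat -> op R T) A B :
  (fun t => hsnorm (opsub (u t) B)) @ \oo --> (0 : R) ->
  cvgC (fun t => tr (opmul A (u t))) (tr (opmul A B)).
Proof.
move=> uB; apply: (@squeeze_cvg0 _ _ (fun t => norm1 A * hsnorm (opsub (u t) B))).
  by move=> t; rewrite cmod_ge0 -trB cmod_tr_mul.
by rewrite -(mulr0 (norm1 A)); apply: cvgM uB; exact: cvg_cst.
Qed.

Variable ev : op R T -> nat -> op R T.
Hypothesis ev_cvg : forall r0, density r0 ->
  (fun t => hsnorm (opsub (ev r0 t) (rhostar r0))) @ \oo --> (0 : R).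

(** The limit [rhostar r0] is itself in SSC, so its distance to the state bounds the infimum. *)
Lemma cvg_achievesSSC : achievesSSC ev.
Proof.
move=> r0 dr0; apply: squeeze_cvg0 (ev_cvg dr0) => t.
have lb : lbound [set hsnorm (opsub (ev r0 t) r) | r in @SSC R n m] 0.
  by move=> _ [r _ <-]; exact: hsnorm_ge0.
have mem : [set hsnorm (opsub (ev r0 t) r) | r in @SSC R n m]
    (hsnorm (opsub (ev r0 t) (rhostar r0))).
  by exists (rhostar r0) => //; exact: SSC_rhostar.
apply/andP; split; last by apply: ge_inf mem; exists 0.
by apply: lb_le_inf lb; eexists; exact: mem.
Qed.

Lemma cvg_achievesSavg (m_gt0 : (0 < m)%N) S :
  achievesSavg ev S <-> exists sigma, selfadj sigma /\ S = avg_loc sigma.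
Proof.
split=> [[_ [sigma [sa H]]]|[sigma [sa SE]]].
  exists sigma; split=> //; apply: op_eq_density => r dr.
  (* One position suffices: the limit prescribed by S-average SSC is compared with the one forced by
     convergence to [rhostar r]. *)
  have [Hs _] := H r dr (Ordinal m_gt0).
  have Hs' := cvgC_tr (loc (Ordinal m_gt0) sigma) (ev_cvg dr).
  by rewrite (cvgC_unique Hs Hs') tr_mul_rhostar rhostar_loc.
split; first exact: cvg_achievesSSC.
exists sigma; split=> // r dr l.
(* An average of local operators is permutation invariant, so its trace against a state and against
   that state's average agree. *)
have SR : rhostar S = S.
  by rewrite SE -(rhostar_loc l) (rhostar_id (fun g => permute_rhostar g _)).
split; last by rewrite -SR -tr_mul_rhostar SR; exact: cvgC_tr (ev_cvg dr).
by rewrite SE -(rhostar_loc l) -tr_mul_rhostar; exact: cvgC_tr (ev_cvg dr).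
Qed.

End Consensus.

(** * Convergence under periodic and under random edge selection *)

Section Convergence.
Variables (R : realType) (n m : nat) (alpha : R) (E : {set 'I_m * 'I_m}).
Local Notation T := (tbasis n m).
Implicit Types (A B : op R T) (w : seq ('I_m * 'I_m)).
Hypothesis alpha01 : 0 < alpha < 1.
Hypothesis m_gt0 : (0 < m)%N.
Hypothesis E_conn : forall j k : 'I_m,
  connect (fun a b : 'I_m => ((a, b) \in E) || ((b, a) \in E)) j k.

Lemma covering_word_contraction w : {subset E <= w} ->
  exists K, exists2 k : R, 0 <= k < 1 & forall A, rhostar A = (fun _ _ => 0) ->
    norm1 (evol_word alpha (flatten (nseq K.+1 w)) A) <= k * norm1 A.
Proof.
move=> Ew; have [K KE] := reachable_full m_gt0 E_conn Ew; exists K.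
apply: evol_word_contraction => // g; apply: weight_gt0 => //.
by rewrite KE inE.
Qed.

Lemma norm1_evol_word_nseq w (k : R) j A : 0 <= k ->
  (forall A, rhostar A = (fun _ _ => 0) ->
    norm1 (evol_word alpha w A) <= k * norm1 A) ->
  rhostar A = (fun _ _ => 0) ->
  norm1 (evol_word alpha (flatten (nseq j w)) A) <= k ^+ j * norm1 A.
Proof.
move=> k0 wk; elim: j A => [|j IH] A A0 /=; first by rewrite expr0 mul1r.
rewrite evol_word_cat (le_trans (IH _ _))//; first by rewrite rhostar_evol_word.
by rewrite exprSr -mulrA ler_wpM2l ?exprn_ge0// wk.
Qed.

Lemma prefix_periodic (sq : nat -> 'I_m * 'I_m) P j :
  (forall t, sq (t + P)%N = sq t) ->
  [seq sq i | i <- iota 0 (j * P)] =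
  flatten (nseq j [seq sq i | i <- iota 0 P]).
Proof.
move=> sqP; elim: j => [//|j IH] /=.
rewrite -IH mulSn iotaD map_cat; congr (_ ++ _).
rewrite add0n -[X in iota X _]addn0 iotaDl -map_comp; apply: eq_map => i /=.
by rewrite addnC sqP.
Qed.

Lemma evol_seq_cvg (sq : nat -> 'I_m * 'I_m) P (r0 : op R T) :
  (forall t, sq (t + P)%N = sq t) ->
  (forall e, e \in E -> exists2 t, (t < P)%N & sq t = e) ->
  (fun t => hsnorm (opsub (evol_seq alpha sq r0 t) (rhostar r0)))
    @ \oo --> (0 : R).
Proof.
move=> sqP sqE; set w := [seq sq i | i <- iota 0 P].
have Ew : {subset E <= w}.
  by move=> e /sqE[t tP <-]; apply: map_f; rewrite mem_iota.
have [K [k k01 kP]] := covering_word_contraction Ew.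
have D0 := rhostar_sub_rhostar r0; set D := opsub _ _ in D0.
have DE t : opsub (evol_seq alpha sq r0 t) (rhostar r0) =
    evol_word alpha [seq sq i | i <- iota 0 t] D.
  exact: evol_word_sub_rhostar.
apply: (@squeeze_cvg0 _ _ (fun t => norm1 (evol_word alpha [seq sq i | i <- iota 0 t] D))).
  by move=> t; rewrite hsnorm_ge0 DE hsnorm_le_norm1.
apply: (@nonincreasing_cvg0 _ _ (K.+1 * P) k (norm1 D)) => //.
- by move=> t; exact: norm1_ge0.
- by move=> t; rewrite -addn1 iotaD map_cat evol_word_cat norm1_evol_word.
(* The first use takes (K+1)P as a period; the second splits each such block into K+1 copies of
   [w]. *)
- move=> j; rewrite prefix_periodic.
    rewrite prefix_periodic//; apply: norm1_evol_word_nseq => //.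
    by case/andP: k01.
  by move=> t; elim: (K.+1) => [|L IH]; rewrite ?addn0// mulSn addnCA addnC sqP.
Qed.

Section RandomSelection.
Variable q : 'I_m * 'I_m -> R.
Hypothesis q_gt0 : forall e, e \in E -> 0 < q e.
Hypothesis q_sum1 : \sum_(e in E) q e = 1.

Definition mean_norm1 A t : R :=
  mean_word E q t (fun w => norm1 (evol_word alpha w A)).

Lemma mean_norm1_ge0 A t : 0 <= mean_norm1 A t.
Proof. by apply: mean_word_ge0 => // w _; exact: norm1_ge0. Qed.

Lemma mean_norm1S A t :
  mean_norm1 A t.+1 = \sum_(e in E) q e * mean_norm1 (gossip alpha e A) t.
Proof. exact: mean_wordS. Qed.

Lemma mean_norm1_cvg0 A : rhostar A = (fun _ _ => 0) ->
  mean_norm1 A @ \oo --> (0 : R).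
Proof.
move=> A0; have Ew : {subset E <= enum E} by move=> e; rewrite mem_enum.
have [K [k /andP[k0 k1] kP]] := covering_word_contraction Ew.
set w := flatten _ in kP.
have wE : all (mem E) w.
  rewrite /w; elim: (K.+1) => [//|L IH] /=; rewrite all_cat IH andbT.
  by apply/allP => e; rewrite mem_enum.
(* The probability that a given block of draws equals the contracting word. *)
set p := \prod_(e <- w) q e.
have p0 : 0 < p by exact: prob_gt0 wE.
have p1 : p <= 1 by exact: prob_le1 wE.
have c0 : 0 <= 1 - (1 - k) * p.
  by rewrite subr_ge0 mulr_ile1 ?subr_ge0 ?(ltW k1) ?(ltW p0)// lerBlDr lerDl.
apply: (@nonincreasing_cvg0 _ _ (size w) (1 - (1 - k) * p) (norm1 A)).
- by move=> t; exact: mean_norm1_ge0.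
(* Conditioning on the first letter reduces monotonicity to a single gossip step, which does not
   increase [norm1]. *)
- move=> t; elim: t A {A0} => [|t IH] A.
    rewrite mean_norm1S [leRHS]mean_word0 -[leRHS]mul1r -q_sum1 mulr_suml.
    apply: ler_sum => e eE; rewrite /mean_norm1 mean_word0 ler_wpM2l ?(ltW (q_gt0 eE))//.
    exact: (norm1_evol_word alpha01 [:: e]).
  rewrite mean_norm1S [leRHS]mean_norm1S; apply: ler_sum => e eE.
  by rewrite ler_wpM2l ?IH// ltW// q_gt0.
- by rewrite c0 ltrBlDr ltrDl mulr_gt0// subr_gt0.
- move=> j; elim: j A A0 => [|j IH] A A0.
    by rewrite mul0n /mean_norm1 mean_word0 expr0 mul1r.
  (* Condition on the first block [v]: its output is still in the kernel of [rhostar], so the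
     induction hypothesis bounds the other j blocks. *)
  rewrite mulSn /mean_norm1 mean_word_cat exprSr -mulrA.
  apply: (@le_trans _ _ (mean_word E q (size w) (fun v =>
      (1 - (1 - k) * p) ^+ j * norm1 (evol_word alpha v A)))).
    apply: le_mean_word => // v _.
    rewrite (le_trans _ (IH _ _))// ?rhostar_evol_word//.
    by apply: le_mean_word => // u _; rewrite evol_word_cat.
  rewrite mean_wordM ler_wpM2l ?exprn_ge0//.
  apply: mean_word_contraction => //; [exact: norm1_ge0| |exact: kP].
  by move=> v _; exact: norm1_evol_word.
Qed.

Lemma evol_avgB A B t : evol_avg alpha E q (opsub A B) t =
  opsub (evol_avg alpha E q A t) (evol_avg alpha E q B t).
Proof.
elim: t => [//|t IH] /=; apply/funext => x; apply/funext => y.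
rewrite /opsub -sumrB; apply: eq_bigr => e _.
by rewrite IH gossipB /opsub mulrBr.
Qed.

Lemma evol_avg_rhostar A t : evol_avg alpha E q (rhostar A) t = rhostar A.
Proof.
elim: t => [//|t IH] /=; apply/funext => x; apply/funext => y.
under eq_bigr do rewrite IH gossip_rhostar.
by rewrite -mulr_suml -rmorph_sum q_sum1 mul1r.
Qed.

(** [evol_avg] unfolds its latest step, whereas [mean_wordS] conditions on the first letter; by
    linearity of [gossip] the former can be unfolded at the first step too. *)
Lemma evol_avgSr A t : evol_avg alpha E q A t.+1 =
  fun x y => \sum_(e in E) (q e)%:C * evol_avg alpha E q (gossip alpha e A) t x y.
Proof.
elim: t => [//|t IH]; apply/funext => x; apply/funext => y.
rewrite -[LHS]/(\sum_(e in E)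
  (q e)%:C * gossip alpha e (evol_avg alpha E q A t.+1) x y) IH.
transitivity (\sum_(e in E) \sum_(f in E) (q e)%:C * ((q f)%:C *
    gossip alpha e (evol_avg alpha E q (gossip alpha f A) t) x y)).
  apply: eq_bigr => e _; rewrite -mulr_sumr; congr (_ * _).
  rewrite gossipE /permute !mulr_sumr -big_split; apply: eq_bigr => f _ /=.
  by rewrite gossipE /permute; ring.
rewrite exchange_big; apply: eq_bigr => f _ /=; rewrite mulr_sumr.
by apply: eq_bigr => e _; rewrite mulrCA.
Qed.

(** Jensen's inequality: the norm of the mean state is at most the mean of the norms. *)
Lemma norm1_evol_avg A t : norm1 (evol_avg alpha E q A t) <= mean_norm1 A t.
Proof.
elim: t A => [|t IH] A; first by rewrite /mean_norm1 mean_word0.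
rewrite evol_avgSr mean_norm1S (le_trans (norm1_comb _ _))//.
  by move=> e eE; rewrite ltW ?q_gt0.
by apply: ler_sum => e eE; rewrite ler_wpM2l ?IH// ltW// q_gt0.
Qed.

Lemma evol_avg_cvg (r0 : op R T) :
  (fun t => hsnorm (opsub (evol_avg alpha E q r0 t) (rhostar r0)))
    @ \oo --> (0 : R).
Proof.
apply: squeeze_cvg0 (mean_norm1_cvg0 (rhostar_sub_rhostar r0)) => t.
rewrite hsnorm_ge0 -{1}(evol_avg_rhostar r0 t) -evol_avgB.
by rewrite (le_trans (hsnorm_le_norm1 _))// norm1_evol_avg.
Qed.

Lemma trajectory_cvg (r0 : op R T) (delta eps : R) : 0 < delta -> 0 < eps ->
  exists2 t : nat, (0 < t)%N & prob_word E q t (fun w =>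
    let D := opsub (evol_word alpha w r0) (rhostar r0) in
    eps%:C < tr (opmul D D)) < delta.
Proof.
move=> d0 e0; set D0 := opsub r0 (rhostar r0).
(* Bounds the norm of the deviation along every trajectory, so Tr(D^2) is at most C times [norm1] of
   D; the added 1 keeps C positive. *)
pose C := norm1 D0 + 1.
have C0 : 0 < C by rewrite ltr_wpDl ?norm1_ge0.
have /cvgrPdist_lt /(_ (delta / (eps^-1 * C)))[] :=
  mean_norm1_cvg0 (rhostar_sub_rhostar r0).
  by rewrite divr_gt0 ?mulr_gt0 ?invr_gt0.
(* The successor of the threshold is taken so that the time is positive. *)
move=> t0 _ /(_ t0.+1 (leqnSn t0)) /=.
rewrite sub0r normrN ger0_norm ?mean_norm1_ge0// => H.
exists t0.+1 => //.
rewrite (le_lt_trans (@markov_word _ _ _ _ _ _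
  (fun w => C * norm1 (evol_word alpha w D0)) eps q_gt0 e0 _ _))//.
- by move=> w _; rewrite mulr_ge0 ?norm1_ge0 ?ltW.
(* The strict order on complex numbers requires equal imaginary parts; only the comparison of real
   parts is kept. *)
- move=> w /=; rewrite evol_word_sub_rhostar -/D0 ltcE => /andP[_ /= /ltW h].
  apply: le_trans h (le_trans (Re_le_cmod _) _).
  rewrite (le_trans (cmod_tr_mul _ _))//.
  rewrite mulrC ler_pM ?norm1_ge0 ?hsnorm_ge0//.
  rewrite (le_trans (hsnorm_le_norm1 _))//.
  by rewrite (le_trans (norm1_evol_word _ _ _))// lerDl.
- rewrite mean_wordM mulrA mulrC -ltr_pdivlMr//.
  by rewrite mulr_gt0 ?invr_gt0.
Qed.

End RandomSelection.
End Convergence.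

Theorem theorem2 (R : realType) (n m : nat) (hn : (2 <= n)%N) (hm : (2 <= m)%N)
  (E : {set 'I_m * 'I_m})
  (hE_irr : forall j k : 'I_m, (j, k) \in E -> j != k)
  (hE_und : forall j k : 'I_m, (j, k) \in E -> (k, j) \notin E)
  (hE_conn : forall j k : 'I_m,
      connect (fun a b : 'I_m => ((a, b) \in E) || ((b, a) \in E)) j k)
  (alpha : R) (halpha : 0 < alpha < 1) :
  (* (i) deterministic periodic edge selection *)
  (forall (sq : nat -> 'I_m * 'I_m) (P : nat),
     (0 < P)%N ->
     (forall t, sq (t + P)%N = sq t) ->
     (forall t, sq t \in E) ->
     (forall e, e \in E -> exists2 t, (t < P)%N & sq t = e) ->
     [/\ (forall rho0 : op R (tbasis n m), density rho0 ->
            (fun t => hsnorm (opsub (evol_seq alpha sq rho0 t) (rhostar rho0)))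
              @ \oo --> (0 : R)),
         achievesSSC (evol_seq (n:=n) alpha sq)
       & forall S : op R (tbasis n m), selfadj S ->
           (achievesSavg (evol_seq (n:=n) alpha sq) S <->
            exists sigma : op R 'I_n, selfadj sigma /\ S = avg_loc sigma)])
  /\
  (* (ii), (iii) i.i.d. random edge selection with law q *)
  (forall q : 'I_m * 'I_m -> R,
     (forall e, e \in E -> 0 < q e) ->
     \sum_(e in E) q e = 1 ->
     [/\ (forall rho0 : op R (tbasis n m), density rho0 ->
            (fun t => hsnorm (opsub (evol_avg alpha E q rho0 t) (rhostar rho0)))
              @ \oo --> (0 : R)),
         achievesSSC (evol_avg (n:=n) alpha E q),
         (forall S : op R (tbasis n m), selfadj S ->
           (achievesSavg (evol_avg (n:=n) alpha E q) S <->
            exists sigma : op R 'I_n, selfadj sigma /\ S = avg_loc sigma))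
       & forall rho0 : op R (tbasis n m), density rho0 ->
           SSC (rhostar rho0) /\
           forall delta eps : R, 0 < delta -> 0 < eps ->
             exists2 T : nat, (0 < T)%N &
               prob_word E q T (fun w =>
                 let D := opsub (evol_word alpha w rho0) (rhostar rho0) in
                 eps%:C < tr (opmul D D)) < delta]).
Proof.
have m_gt0 : (0 < m)%N by exact: ltnW.
split=> [sq P _ sqP _ sqE|q q_gt0 q_sum1].
  have cv r0 : density r0 -> hsnorm (opsub (evol_seq (n := n) alpha sq r0 t)
      (rhostar r0)) @[t --> \oo] --> (0 : R).
    by move=> _; exact: (evol_seq_cvg halpha m_gt0 hE_conn _ sqP sqE).
  split=> //; first exact: cvg_achievesSSC.
  by move=> S _; exact: cvg_achievesSavg.
have cv r0 : density r0 -> hsnorm (opsub (evol_avg (n := n) alpha E q r0 t)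
    (rhostar r0)) @[t --> \oo] --> (0 : R).
  by move=> _; exact: evol_avg_cvg.
split=> //; first exact: cvg_achievesSSC.
  by move=> S _; exact: cvg_achievesSavg.
move=> r0 dr0; split; first exact: SSC_rhostar.
by move=> delta eps d0 e0; exact: trajectory_cvg.
Qed.
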